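(* Let $A$ be a two-by-two matrix with complex entries and eigenvalues $\lambda_1$ and $\lambda_2$ (listed with algebraic multiplicity). Then the field of values $F(A) = \{ x^* A x : x \in \mathbb{C}^2,\ x^* x = 1 \} \subseteq \mathbb{C}$ is a (possibly degenerate) elliptical disk that is centered at $\frac{1}{2}\operatorname{tr}(A)$, has foci $\lambda_1$ and $\lambda_2$, and has minor axis length equal to $$\sqrt{\operatorname{tr}(A^*A) - |\lambda_1|^2 - |\lambda_2|^2}.$$
   Context: Here $A^*$ and $x^*$ denote conjugate transposes, $\operatorname{tr}$ denotes the trace, and $\mathbb{C}$ is identified with the Euclidean plane $\mathbb{R}^2$. An elliptical disk means the closed region bounded by an ellipse, i.e. the ellipse together with its interior. ''Minor axis length'' means the full length of the minor axis (twice the semi-minor axis). Thus the elliptical disk with foci $\lambda_1, \lambda_2$ and minor axis length $d \ge 0$ is the set $\{ z \in \mathbb{C} : |z - \lambda_1| + |z - \lambda_2| \le \sqrt{|\lambda_1 - \lambda_2|^2 + d^2} \}$, whose center is $(\lambda_1+\lambda_2)/2$. Degenerate cases are allowed: when $d = 0$ the elliptical disk is the line segment joining $\lambda_1$ and $\lambda_2$ (a single point if $\lambda_1 = \lambda_2$), and when $\lambda_1 = \lambda_2$ and $d > 0$ it is a closed circular disk of diameter $d$. *)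

(* Defs.v *)
From HB Require Import structures.
From mathcomp Require Export all_boot all_order all_algebra.
From mathcomp Require Export boolp classical_sets reals.
From mathcomp.real_closed Require Export complex.

Set Implicit Arguments.
Unset Strict Implicit.
Unset Printing Implicit Defensive.

Import Order.TTheory GRing.Theory Num.Theory.

Local Open Scope classical_set_scope.
Local Open Scope ring_scope.
Local Open Scope sesquilinear_scope.

(* The complex plane is R[i].  Its norm `|z| takes values in R[i] itself, and
   its order is the partial one in which x <= y forces y - x to be real and
   nonnegative; so 0 <= d says that d is a nonnegative real number, and on
   nonnegative reals sqrtC is the usual square root. *)

Definition field_of_values (R : realType) (n : nat) (A : 'M[R[i]]_n) :
    set R[i] :=
  [set (x ^t* *m A *m x) ord0 ord0 |
     x in [set x : 'cV[R[i]]_n | x ^t* *m x = 1%:M]].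

(* d is the full length of the minor axis, so the major axis has length
   sqrt (|f1 - f2|^2 + d^2). *)
Definition elliptical_disk (R : realType) (f1 f2 d : R[i]) : set R[i] :=
  [set z | `|z - f1| + `|z - f2| <= sqrtC (`|f1 - f2| ^+ 2 + d ^+ 2)].

Definition is_elliptical_disk (R : realType)
    (S : set R[i]) (c f1 f2 d : R[i]) : Prop :=
  [/\ 0 <= d, c = (f1 + f2) / 2 & S = elliptical_disk f1 f2 d].

(* Main.v *)
(** By Schur triangularization we may take [A] triangular, with diagonal [a],
    [b] and off-diagonal entry [c].  The value at a unit vector [x] is
    [p a + (1 - p) b + c w], where [p = |x_0|^2] and [w] can be any number with
    [|w|^2 = p (1 - p)].  Hence [z] lies in the field of values iff
    [|p (z - a) + (1 - p) (z - b)|^2 = |c|^2 p (1 - p)] for some [p] in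
    [[0, 1]].
    Expanding the left-hand side by Stewart's identity turns this into
    [s^2 p (1 - p) = p |z - a|^2 + (1 - p) |z - b|^2] with
    [s^2 = |a - b|^2 + |c|^2], and this is solvable in [[0, 1]] iff
    [|z - a| + |z - b| <= s]. *)

Require Import Defs.
From mathcomp Require Import spectral mxpoly ring lra.

Import Order.TTheory GRing.Theory Num.Theory.

Local Open Scope classical_set_scope.
Local Open Scope ring_scope.
Local Open Scope sesquilinear_scope.

(** * The weight equation over the reals *)

(** Multiplied by [p * (1 - p)], the difference [s ^+ 2 - (x + y) ^+ 2] is the square of
    [p * x - (1 - p) * y]. Cancelling the factor takes [0 < p < 1], which the equation forces unless
    [x] or [y] is 0; in that case the bound on [|x - y|] is already the claim. *)
Lemma add_le_of_weight (R : realFieldType) (p s x y : R) :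
  0 <= p <= 1 -> 0 <= s -> 0 <= x -> 0 <= y -> `|x - y| <= s ->
  s ^+ 2 * (p * (1 - p)) = p * x ^+ 2 + (1 - p) * y ^+ 2 -> x + y <= s.
Proof.
move=> /andP[p0 p1] s0 x0 y0; rewrite ler_norml => /andP[xy yx] E.
have [x_eq0|xN0] := eqVneq x 0; first by lra.
have [y_eq0|yN0] := eqVneq y 0; first by lra.
have {xN0}x_gt0 : 0 < x by rewrite lt_def xN0.
have {yN0}y_gt0 : 0 < y by rewrite lt_def yN0.
have pq_gt0 : 0 < p * (1 - p).
  rewrite lt_def mulr_ge0 ?subr_ge0 // andbT.
  apply: contra_eqN E => /eqP ->; rewrite mulr0 eq_sym paddr_eq0; last 2 first.
  - by rewrite mulr_ge0 ?sqr_ge0.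
  - by rewrite mulr_ge0 ?sqr_ge0 ?subr_ge0.
  rewrite !mulf_eq0 (gt_eqF x_gt0) (gt_eqF y_gt0) !orbF.
  by apply/negP => /andP[/eqP ? /eqP ?]; lra.
rewrite -ler_sqr ?nnegrE ?addr_ge0 // -(ler_pM2r pq_gt0) E -subr_ge0.
have -> : p * x ^+ 2 + (1 - p) * y ^+ 2 - (x + y) ^+ 2 * (p * (1 - p)) =
  (p * x - (1 - p) * y) ^+ 2 by ring.
exact: sqr_ge0.
Qed.

Lemma weight_of_add_le {R : rcfType} {s x y : R} :
  0 <= x -> 0 <= y -> x + y <= s -> exists2 p : R, 0 <= p <= 1 &
  s ^+ 2 * (p * (1 - p)) = p * x ^+ 2 + (1 - p) * y ^+ 2.
Proof.
move=> x0 y0 xys.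
pose f : {poly R} :=
  'X * (x ^+ 2)%:P + (1 - 'X) * (y ^+ 2)%:P - (s ^+ 2)%:P * ('X * (1 - 'X)).
have fE p : f.[p] = p * x ^+ 2 + (1 - p) * y ^+ 2 - s ^+ 2 * (p * (1 - p)).
  by rewrite /f !hornerE.
have [xy0|xyN0] := eqVneq (x + y) 0.
  exists 0; first by lra.
  have -> : y = 0 by lra.
  ring.
have xy_gt0 : 0 < x + y by rewrite lt_def xyN0 addr_ge0.
(* At [p0] the two sides of the equation are [s^2] and [(x + y)^2] times
   [x y / (x + y)^2], and at [0] they are [0] and [y^2], so a solution lies
   in between. *)
set p0 := y / (x + y).
have p0_ge0 : 0 <= p0 by rewrite divr_ge0 // ltW.
have p0_le1 : p0 <= 1 by rewrite ler_pdivrMr // mul1r lerDr.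
have fp0 : f.[p0] <= 0.
  have -> : f.[p0] = x * y / (x + y) ^+ 2 * ((x + y) ^+ 2 - s ^+ 2).
    rewrite fE /p0; field; exact: xyN0.
  rewrite mulr_ge0_le0 ?divr_ge0 ?mulr_ge0 ?exprn_ge0 ?addr_ge0 // subr_le0.
  by rewrite ler_sqr ?nnegrE ?addr_ge0 // (le_trans _ xys) ?addr_ge0.
have f0 : 0 <= f.[0] by rewrite fE; have := sqr_ge0 y; lra.
have [p /itvP pI /rootP fp] : exists2 p, p \in `[0, p0] & root (- f) p.
  by apply: poly_ivt; rewrite ?hornerN ?oppr_le0 ?oppr_ge0 // f0.
exists p; first by rewrite pI (le_trans _ p0_le1) ?pI.
by move: fp; rewrite hornerN fE; lra.
Qed.

(** * Invariance under unitary conjugation *)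

Lemma field_of_values_conj_subset (R : realType) (n : nat) (U A : 'M[R[i]]_n) :
  U \is unitarymx ->
  field_of_values (U *m A *m U ^t*) `<=` field_of_values A.
Proof.
move=> Uu z [x xx <-]; exists (U ^t* *m x) => /=.
  by rewrite trmx_mul map_mxM /= trmxCK mulmxA mulmxtVK //; exact: xx.
by rewrite trmx_mul map_mxM /= trmxCK !mulmxA.
Qed.

Lemma field_of_values_conj (R : realType) (n : nat) (U A : 'M[R[i]]_n) :
  U \is unitarymx ->
  field_of_values (U *m A *m U ^t*) = field_of_values A.
Proof.
move=> Uu; apply/seteqP; split; first exact: field_of_values_conj_subset.
have {1}-> : A = U ^t* *m (U *m A *m U ^t*) *m U ^t* ^t*.
  by rewrite trmxCK !mulmxA mulmxKtV // (mulmx1C (unitarymxP Uu)) mul1mx.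
by apply: field_of_values_conj_subset; rewrite trmxC_unitary.
Qed.

Lemma trace_gram_conj (C : numClosedFieldType) (n : nat) (U A : 'M[C]_n) :
  U \is unitarymx ->
  \tr ((U *m A *m U ^t*) ^t* *m (U *m A *m U ^t*)) = \tr (A ^t* *m A).
Proof.
move=> Uu; rewrite !trmx_mul !map_mxM /= trmxCK !mulmxA mulmxKtV //.
by rewrite -2!mulmxA mxtrace_mulC -!mulmxA (mulmx1C (unitarymxP Uu)) mulmx1.
Qed.

(** * The field of values of a lower triangular matrix *)

Lemma sum_ord2 (V : nmodType) (F : 'I_2 -> V) :
  \sum_i F i = F ord0 + F ord_max.
Proof.
by rewrite big_ord_recr big_ord1; congr (F _ + _); apply: val_inj.
Qed.

Lemma field_of_values_trig (R : realType) (T : 'M[R[i]]_2) (z : R[i]) :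
  T ord0 ord_max = 0 ->
  field_of_values T z <-> exists2 p : R[i], 0 <= p <= 1 &
    `|p * (z - T ord0 ord0) + (1 - p) * (z - T ord_max ord_max)| ^+ 2 =
    `|T ord_max ord0| ^+ 2 * (p * (1 - p)).
Proof.
move=> T01; set a := T ord0 ord0; set b := T ord_max ord_max.
set c := T ord_max ord0.
have fovE (x : 'cV[R[i]]_2) : (x ^t* *m T *m x) ord0 ord0 =
    `|x ord0 ord0| ^+ 2 * a + `|x ord_max ord0| ^+ 2 * b
    + c * ((x ord_max ord0)^* * x ord0 ord0).
  rewrite !normCK mxE sum_ord2 !mxE !sum_ord2 !mxE.
  rewrite T01 -/a -/b -/c; ring.
have unitE (x : 'cV[R[i]]_2) : x ^t* *m x = 1%:M <->
    `|x ord0 ord0| ^+ 2 + `|x ord_max ord0| ^+ 2 = 1.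
  have E : (x ^t* *m x) ord0 ord0 =
      `|x ord0 ord0| ^+ 2 + `|x ord_max ord0| ^+ 2.
    by rewrite !normCK mxE sum_ord2 !mxE ![_^* * _]mulrC.
  split=> [xx|xx]; first by rewrite -E xx mxE.
  by apply/matrixP => i j; rewrite !ord1 E xx mxE.
split=> [[x /unitE xx <-]|[p /andP[p0 p1] E]].
  exists (`|x ord0 ord0| ^+ 2).
    by rewrite exprn_ge0 //= -xx lerDl exprn_ge0.
  have -> : 1 - `|x ord0 ord0| ^+ 2 = `|x ord_max ord0| ^+ 2.
    by rewrite -xx addrC addKr.
  rewrite fovE; set w := _^* * _; set p := `|x ord0 ord0| ^+ 2 in xx *.
  set q := `|x ord_max ord0| ^+ 2 in xx *.
  have -> : p * (p * a + q * b + c * w - a) + q * (p * a + q * b + c * w - b) =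
      (p + q) * (p * a + q * b + c * w) - p * a - q * b by ring.
  rewrite xx mul1r.
  have -> : p * a + q * b + c * w - p * a - q * b = c * w by ring.
  by rewrite normrM exprMn /w normrM norm_conjC exprMn [p * q]mulrC.
(* If [c] is nonzero, [w] is found by division. If [c = 0], the equation already gives
   [z = p * a + (1 - p) * b], and any [w] of the right modulus will do. *)
have [w zE wE] : exists2 w,
    z = p * a + (1 - p) * b + c * w & `|w| ^+ 2 = p * (1 - p).
  have pq0 : 0 <= p * (1 - p) by rewrite mulr_ge0 ?subr_ge0.
  have [c0|cN0] := eqVneq c 0.
    exists (sqrtC (p * (1 - p))); last first.
      by rewrite ger0_norm ?sqrtC_ge0 // sqrtCK.
    move: E; rewrite c0 normr0 expr0n mul0r => /eqP.
    rewrite expf_eq0 normr_eq0 /= => /eqP E.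
    apply/eqP; rewrite -subr_eq0; apply/eqP; rewrite -[RHS]E; ring.
  exists ((p * (z - a) + (1 - p) * (z - b)) / c).
    by rewrite mulrCA divff // mulr1; ring.
  by rewrite normf_div expr_div_n E mulrC mulKf // expf_neq0 ?normr_eq0.
pose col (u v : R[i]) : 'cV[R[i]]_2 := \col_i (if i == ord0 then u else v).
(* With first coordinate [sqrtC p], the condition that [x_1^* x_0 = w] forces the second to be
   [w^* / sqrtC p]. At [p = 0] this breaks down, but then [w = 0] and the second basis vector
   serves. *)
have [p_eq0|pN0] := eqVneq p 0.
  have w0 : w = 0.
    by apply/eqP; rewrite -normr_eq0 -sqrf_eq0 wE p_eq0 mul0r.
  exists (col 0 1).
    by apply/unitE; rewrite !mxE /= normr0 normr1 expr0n expr1n add0r.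
  by rewrite fovE !mxE /= zE p_eq0 w0 normr0 normr1 expr0n expr1n /=; ring.
have sN0 : sqrtC p != 0 by rewrite sqrtC_eq0.
have s2 : `|sqrtC p| ^+ 2 = p by rewrite ger0_norm ?sqrtC_ge0 // sqrtCK.
have v2 : `|w^* / sqrtC p| ^+ 2 = 1 - p.
  by rewrite normf_div norm_conjC expr_div_n s2 wE mulrC mulKf.
exists (col (sqrtC p) (w^* / sqrtC p)).
  by apply/unitE; rewrite !mxE /= s2 v2 addrC subrK.
rewrite fovE !mxE /= s2 v2 zE /= rmorphM fmorphV /= (conjCK w).
have -> : (sqrtC p)^* = sqrtC p by apply/CrealP; rewrite ger0_real ?sqrtC_ge0.
by rewrite divfK.
Qed.

(** * The elliptical disk in terms of weights *)

(** Stewart's identity for the triangle 0, [u], [v], with the cevian from 0 to a point of the line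
    through [u] and [v]. *)
Lemma sqr_normC_convex (C : numClosedFieldType) (p u v : C) :
  p \is Num.real ->
  `|p * u + (1 - p) * v| ^+ 2 =
  p * `|u| ^+ 2 + (1 - p) * `|v| ^+ 2 - `|u - v| ^+ 2 * (p * (1 - p)).
Proof.
move=> /CrealP pJ; rewrite !normCK !(rmorphD, rmorphN, rmorphM, rmorph1) /= pJ.
ring.
Qed.

(** Used to move the weight equation from [R[i]], where the order is partial, to [R], where the
    intermediate value argument applies. *)
Lemma ge0_real_complex {R : rcfType} {x : R[i]} :
  0 <= x -> exists2 r : R, 0 <= r & x = (r%:C)%C.
Proof.
move=> x0; have /RRe_real xE := ger0_real x0.
by exists (complex.Re x); rewrite // -ler0c xE.
Qed.

(** The condition on [p] has the shape of the one in [field_of_values_trig], with [d] for the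
    modulus of the off-diagonal entry, so the two sets can be compared pointwise. *)
Lemma elliptical_diskE (R : realType) (f1 f2 d z : R[i]) : 0 <= d ->
  elliptical_disk f1 f2 d z <-> exists2 p : R[i], 0 <= p <= 1 &
    `|p * (z - f1) + (1 - p) * (z - f2)| ^+ 2 = d ^+ 2 * (p * (1 - p)).
Proof.
move=> d0; rewrite /elliptical_disk /=.
set s := sqrtC _.
have s2 : s ^+ 2 = `|f1 - f2| ^+ 2 + d ^+ 2 by rewrite sqrtCK.
have s0 : 0 <= s by rewrite sqrtC_ge0 addr_ge0 ?exprn_ge0.
(* The reverse triangle inequality bounds the left side by [|f1 - f2|]; this supplies the side
   condition of [add_le_of_weight]. *)
have xy_le : `| `|z - f1| - `|z - f2| | <= s.
  apply: le_trans (ler_dist_dist _ _) _.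
  have -> : z - f1 - (z - f2) = - (f1 - f2) by ring.
  by rewrite normrN -(@ler_pXn2r _ 2) ?nnegrE // s2 lerDl exprn_ge0.
have weightE p : 0 <= p ->
    `|p * (z - f1) + (1 - p) * (z - f2)| ^+ 2 = d ^+ 2 * (p * (1 - p)) <->
    s ^+ 2 * (p * (1 - p)) = p * `|z - f1| ^+ 2 + (1 - p) * `|z - f2| ^+ 2.
  move=> p0; rewrite sqr_normC_convex ?ger0_real // s2.
  have -> : z - f1 - (z - f2) = - (f1 - f2) by ring.
  rewrite normrN; split=> [E|<-]; last by ring.
  by rewrite mulrDl -E; ring.
have [S S0 SE] := ge0_real_complex s0.
have [X X0 XE] := ge0_real_complex (normr_ge0 (z - f1)).
have [Y Y0 YE] := ge0_real_complex (normr_ge0 (z - f2)).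
split=> [|[p /andP[p0 p1] /weightE-/(_ p0)]].
  rewrite XE YE SE -rmorphD lecR => /(weight_of_add_le X0 Y0)[p /andP[p0 p1] E].
  have pC0 : 0 <= (p%:C)%C by rewrite ler0c.
  exists (p%:C)%C; first by rewrite pC0 -[1]/((1 : R)%:C)%C lecR.
  apply/(weightE _ pC0); rewrite XE YE SE -(rmorph1 (real_complex R)).
  by rewrite -!(rmorphXn, rmorphB, rmorphM, rmorphD) E.
have [r r0 rE] := ge0_real_complex p0.
have r1 : r <= 1 by move: p1; rewrite rE -(rmorph1 (real_complex R)) lecR.
have XYS : `|X - Y| <= S.
  move: xy_le; rewrite XE YE SE -rmorphB normc_def /= expr0n addr0.
  by rewrite sqrtr_sqr lecR.
rewrite XE YE SE rE -(rmorph1 (real_complex R)).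
rewrite -!(rmorphXn, rmorphB, rmorphM, rmorphD) lecR => /complexI.
by apply: add_le_of_weight; rewrite ?r0.
Qed.

Lemma field_of_values_trig_disk (R : realType) (T : 'M[R[i]]_2) :
  T ord0 ord_max = 0 ->
  field_of_values T = elliptical_disk (T ord0 ord0) (T ord_max ord_max)
    `|T ord_max ord0|.
Proof.
move=> T01; apply/funext => z; apply/propext.
split=> [/(field_of_values_trig _ _ _ T01)|].
  by move=> /elliptical_diskE; apply; rewrite normr_ge0.
move=> /elliptical_diskE-/(_ (normr_ge0 _)).
by move=> /(field_of_values_trig _ _ _ T01).
Qed.

(** * Reading off the axis and the foci *)

Lemma mxtrace_gram_trig (C : numClosedFieldType) (T : 'M[C]_2) :
  T ord0 ord_max = 0 ->
  \tr (T ^t* *m T) =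
  `|T ord0 ord0| ^+ 2 + `|T ord_max ord_max| ^+ 2 + `|T ord_max ord0| ^+ 2.
Proof.
move=> T01; rewrite /mxtrace sum_ord2 !mxE !sum_ord2 !mxE T01 !normCK.
ring.
Qed.

Lemma char_poly_similar (R : comNzRingType) (n : nat) (U V A : 'M[R]_n) :
  U *m V = 1%:M -> char_poly (U *m A *m V) = char_poly A.
Proof.
move=> UV; rewrite /char_poly /char_poly_mx.
have UVp : map_mx polyC U *m map_mx polyC V = 1%:M.
  by rewrite -map_mxM UV map_mx1.
have -> : 'X%:M - map_mx polyC (U *m A *m V) =
    map_mx polyC U *m ('X%:M - map_mx polyC A) *m map_mx polyC V.
  rewrite mulmxBr mulmxBl !map_mxM; congr (_ - _).
  by rewrite -mulmxA mul_scalar_mx -scalemxAr UVp scalemx1.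
by rewrite !det_mulmx mulrAC -det_mulmx UVp det1 mul1r.
Qed.

(** Evaluating at [c] shows that [c] is [a] or [b], and cancelling the common factor matches the
    other roots. Both orders must be allowed, since the diagonal of the Schur form may list the
    eigenvalues either way. *)
Lemma eq_mul_XsubC (F : idomainType) (a b c d : F) :
  ('X - a%:P) * ('X - b%:P) = ('X - c%:P) * ('X - d%:P) ->
  (a = c /\ b = d) \/ (a = d /\ b = c).
Proof.
have XI (x y z : F) :
    ('X - x%:P) * ('X - y%:P) = ('X - x%:P) * ('X - z%:P) -> y = z.
  by move=> /(mulfI (negbT (polyXsubC_eq0 x)))/addrI/oppr_inj/polyC_inj.
move=> E; have /(congr1 (horner^~ c)) := E.
rewrite !hornerE subrr mul0r => /eqP; rewrite mulf_eq0 !subr_eq0.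
by case/orP=> /eqP Ec; [left|right]; split=> //; apply/(XI c);
  rewrite -E Ec // mulrC.
Qed.

Lemma elliptical_diskC (R : realType) (f1 f2 d : R[i]) :
  elliptical_disk f1 f2 d = elliptical_disk f2 f1 d.
Proof.
rewrite /elliptical_disk [`|f1 - _|]distrC; apply/seteqP.
by split=> z /=; rewrite addrC.
Qed.

Theorem theorem1p1 (R : realType) (A : 'M[R[i]]_2) (l1 l2 : R[i])
    (hA : char_poly A = ('X - l1%:P) * ('X - l2%:P)) :
  0 <= \tr (A ^t* *m A) - `|l1| ^+ 2 - `|l2| ^+ 2 /\
  is_elliptical_disk (field_of_values A) (\tr A / 2) l1 l2
    (sqrtC (\tr (A ^t* *m A) - `|l1| ^+ 2 - `|l2| ^+ 2)).
Proof.
have [U Uu Atrig] := Schur A (isT : (0 < 2)%N).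
set T := U *m A *m U ^t*.
have {Atrig} Ttrig : is_trig_mx T by rewrite /T -conjymx.
have T01 : T ord0 ord_max = 0 by apply: (is_trig_mxP Ttrig).
have fovE := field_of_values_trig_disk _ T T01.
have trE := mxtrace_gram_trig _ T T01.
rewrite field_of_values_conj // in fovE; rewrite trace_gram_conj // in trE.
have : ('X - (T ord0 ord0)%:P) * ('X - (T ord_max ord_max)%:P) =
    ('X - l1%:P) * ('X - l2%:P).
  rewrite -hA -(char_poly_similar _ _ U (U ^t*) A) ?(unitarymxP Uu) //.
  rewrite -/T char_poly_trig // big_ord_recr big_ord1.
  by congr (('X - (T _ _)%:P) * _); apply: val_inj.
move=> /eq_mul_XsubC l12.
(* The Frobenius norm is unitarily invariant and the diagonal of [T] carries the eigenvalues, so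
   only the off-diagonal entry is left; this also gives nonnegativity. *)
have dE : \tr (A ^t* *m A) - `|l1| ^+ 2 - `|l2| ^+ 2 = `|T ord_max ord0| ^+ 2.
  by rewrite trE; case: l12 => -[-> ->]; ring.
rewrite dE exprn_ge0 // sqrCK //; split=> //; split=> //.
  have -> : \tr A = \tr T.
    by rewrite mxtrace_mulC mulmxA (mulmx1C (unitarymxP Uu)) mul1mx.
  by rewrite /mxtrace sum_ord2; case: l12 => -[-> ->] //; rewrite addrC.
by rewrite fovE; case: l12 => -[-> ->] //; exact: elliptical_diskC.
Qed.
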